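(* Let $\omega\in[0,1]$ and let $A\in\mathbb{C}^{m\times m}$, $B\in\mathbb{C}^{m\times n}$, $C\in\mathbb{C}^{n\times m}$, $D\in\mathbb{C}^{n\times n}$ be such that $XCX-XD-AX+B=0$ is in class $\mathbb{H}^\omega$, and suppose that $Q_\omega\mathbf{1}>0$, where $Q=\begin{pmatrix}D&-C\\-B&A\end{pmatrix}$. Let $\Phi$ and $\Psi$ be the extremal solutions of $XCX-XD-AX+B=0$ and of its dual $YBY-YA-DY+C=0$, respectively. Let $\{E_k\},\{F_k\},\{G_k\},\{H_k\}$ be generated by ADDA applied to $XCX-XD-AX+B=0$ with complex parameters $\alpha,\beta$ such that $\omega\,\mathrm{Re}(\alpha)+(1-\omega)\,\mathrm{Im}(\alpha)>0$, $\omega\,\mathrm{Re}(\beta)+(1-\omega)\,\mathrm{Im}(\beta)>0$ and $$\frac{\omega\,\mathrm{Re}(\alpha)+(1-\omega)\,\mathrm{Im}(\alpha)+q_i}{|\alpha+[Q]_{ii}|}\,|\beta-[Q]_{ii}|<\omega\,\mathrm{Re}(\beta)+(1-\omega)\,\mathrm{Im}(\beta)-q_i,\quad i=1,\dots,n,$$ $$\frac{\omega\,\mathrm{Re}(\beta)+(1-\omega)\,\mathrm{Im}(\beta)+q_i}{|\beta+[Q]_{ii}|}\,|\alpha-[Q]_{ii}|<\omega\,\mathrm{Re}(\alpha)+(1-\omega)\,\mathrm{Im}(\alpha)-q_i,\quad i=n+1,\dots,n+m,$$ where $q_i=\sum_{j\ne i}|[Q]_{ij}|$. Then $\{H_k\}$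 and $\{G_k\}$ converge quadratically to $\Phi$ and $\Psi$, respectively.
   Context: For a complex square matrix $M$ and a real $\omega\in[0,1]$, the $\omega$-comparison matrix $M_\omega$ is the real matrix with entries $[M_\omega]_{ii}=\omega\,\mathrm{Re}([M]_{ii})+(1-\omega)\,\mathrm{Im}([M]_{ii})$ and $[M_\omega]_{ij}=-|[M]_{ij}|$ for $i\ne j$. A real square matrix $M$ is a nonsingular M-matrix if all its off-diagonal entries are nonpositive and $Mu>0$ (entrywise) for some vector $u>0$. $\mathbf{1}$ is the all-ones column vector. The equation is in class $\mathbb{H}^\omega$ if $Q_\omega$ is a nonsingular M-matrix. Extremal solutions: $\Phi$ is the unique solution of $XCX-XD-AX+B=0$ such that every eigenvalue $\lambda$ of $D-C\Phi$ satisfies $\omega\,\mathrm{Re}(\lambda)+(1-\omega)\,\mathrm{Im}(\lambda)>0$; $\Psi$ is the unique solution of $YBY-YA-DY+C=0$ such that every eigenvalue $\lambda$ of $A-B\Psi$ satisfies the same inequality (both exist and are unique under these hypotheses). ADDA with parameters $\alpha,\beta$: put $A_\beta=A+\beta I$, $D_\alpha=D+\alpha I$, $W_{\alpha\beta}=A_\beta-BD_\alpha^{-1}C$, $V_{\alpha\beta}=D_\alpha-CA_\beta^{-1}B$, and $$E_0=I-(\alpha+\beta)V_{\alpha\beta}^{-1},\ F_0=I-(\alpha+\beta)W_{\alpha\beta}^{-1},\ G_0=(\alpha+\beta)D_\alpha^{-1}CW_{\alpha\beta}^{-1},\ H_0=(\alpha+\beta)W_{\alpha\beta}^{-1}BD_\alpha^{-1};$$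 for $k\ge0$, $$E_{k+1}=E_k(I-G_kH_k)^{-1}E_k,\quad F_{k+1}=F_k(I-H_kG_k)^{-1}F_k,$$ $$G_{k+1}=G_k+E_k(I-G_kH_k)^{-1}G_kF_k,\quad H_{k+1}=H_k+F_k(I-H_kG_k)^{-1}H_kE_k.$$ Quadratic convergence of the doubling algorithm means $\limsup_{k\to\infty}\|H_k-\Phi\|^{1/2^k}<1$ and $\limsup_{k\to\infty}\|G_k-\Psi\|^{1/2^k}<1$. *)

(* Defs.v *)
From HB Require Import structures.
From mathcomp Require Import all_boot all_order all_algebra.
From mathcomp Require Import complex.
From mathcomp Require Import all_classical all_reals all_analysis.

Set Implicit Arguments.
Unset Strict Implicit.
Unset Printing Implicit Defensive.

Import Order.TTheory GRing.Theory Num.Theory.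

Local Open Scope ring_scope.
Local Open Scope complex_scope.

(* Real-valued modulus; the generic norm on R[i] takes its values in R[i]. *)
Definition cabs (R : realType) (z : R[i]) : R := ComplexField.Normc.normc z.

Definition omega_part (R : realType) (w : R) (z : R[i]) : R :=
  w * complex.Re z + (1 - w) * complex.Im z.

Definition omega_comparison (R : realType) (p : nat) (w : R)
    (M : 'M[R[i]]_p) : 'M[R]_p :=
  \matrix_(i, j) if i == j then omega_part w (M i i) else - cabs (M i j).

Definition mx_pos (R : realType) (p q : nat) (M : 'M[R]_(p, q)) : Prop :=
  forall i j, 0 < M i j.

Definition nonsingular_M_matrix (R : realType) (p : nat) (M : 'M[R]_p) : Prop :=
  (forall i j, i != j -> M i j <= 0) /\
  (exists2 u : 'cV[R]_p, mx_pos u & mx_pos (M *m u)).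

Section Riccati.
Variables (R : realType) (m n : nat).
Variables (A : 'M[R[i]]_m) (B : 'M[R[i]]_(m, n)).
Variables (C : 'M[R[i]]_(n, m)) (D : 'M[R[i]]_n).

Definition nare_mx : 'M[R[i]]_(n + m) := block_mx D (- C) (- B) A.

Definition class_H (w : R) : Prop :=
  nonsingular_M_matrix (omega_comparison w nare_mx).

(* Uniqueness of the extremal solution is a theorem for equations in class_H,
   so it is not made part of the definition.  The dual equation
   Y B Y - Y A - D Y + C = 0 is obtained by exchanging A with D and B with C. *)
Definition extremal_solution (w : R) (X : 'M[R[i]]_(m, n)) : Prop :=
  X *m C *m X - X *m D - A *m X + B = 0 /\
  forall lambda : R[i],
    eigenvalue (D - C *m X) lambda -> 0 < omega_part w lambda.

Variables (alpha beta : R[i]).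

Definition adda_A : 'M[R[i]]_m := A + beta%:M.
Definition adda_D : 'M[R[i]]_n := D + alpha%:M.
Definition adda_W : 'M[R[i]]_m := adda_A - B *m invmx adda_D *m C.
Definition adda_V : 'M[R[i]]_n := adda_D - C *m invmx adda_A *m B.

Definition adda_sequences (E : nat -> 'M[R[i]]_n) (F : nat -> 'M[R[i]]_m)
    (G : nat -> 'M[R[i]]_(n, m)) (H : nat -> 'M[R[i]]_(m, n)) : Prop :=
  [/\ E 0%N = 1%:M - (alpha + beta) *: invmx adda_V,
      F 0%N = 1%:M - (alpha + beta) *: invmx adda_W,
      G 0%N = (alpha + beta) *: (invmx adda_D *m C *m invmx adda_W) &
      H 0%N = (alpha + beta) *: (invmx adda_W *m B *m invmx adda_D)] /\
  forall k : nat,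
  [/\ E k.+1 = E k *m invmx (1%:M - G k *m H k) *m E k,
      F k.+1 = F k *m invmx (1%:M - H k *m G k) *m F k,
      G k.+1 = G k + E k *m invmx (1%:M - G k *m H k) *m G k *m F k &
      H k.+1 = H k + F k *m invmx (1%:M - H k *m G k) *m H k *m E k].

(* invmx is total (invmx M = M when M is singular); this predicate says that
   every inverse taken by the algorithm is a genuine one. *)
Definition adda_well_defined (G : nat -> 'M[R[i]]_(n, m))
    (H : nat -> 'M[R[i]]_(m, n)) : Prop :=
  [/\ adda_A \in unitmx, adda_D \in unitmx,
      adda_W \in unitmx & adda_V \in unitmx] /\
  forall k : nat, (1%:M - G k *m H k \in unitmx) /\
                  (1%:M - H k *m G k \in unitmx).

End Riccati.

Definition is_matrix_norm (R : realType) (p q : nat)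
    (N : 'M[R[i]]_(p, q) -> R) : Prop :=
  [/\ forall M, 0 <= N M,
      forall M, N M = 0 -> M = 0,
      forall (a : R[i]) M, N (a *: M) = cabs a * N M &
      forall M M', N (M + M') <= N M + N M'].

(* The limsup is taken in the extended reals, so it is meaningful even for
   unbounded sequences.  Since all norms on a finite-dimensional space are
   equivalent, the property does not depend on the norm; it is required for
   every norm. *)
Definition quadratic_cvg (R : realType) (p q : nat)
    (X : nat -> 'M[R[i]]_(p, q)) (L : 'M[R[i]]_(p, q)) : Prop :=
  forall N : 'M[R[i]]_(p, q) -> R, is_matrix_norm N ->
    (limn_esup (fun k => (powR (N (X k - L)) (1 / 2 ^+ k))%:E) < 1%:E)%E.

(* Main.v *)
Require Import Defs.
From HB Require Import structures.
From mathcomp Require Import all_boot all_order all_algebra.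
From mathcomp Require Import complex.
From mathcomp Require Import all_classical all_reals all_analysis.
From mathcomp Require Import ring lra.

Set Implicit Arguments.
Unset Strict Implicit.
Unset Printing Implicit Defensive.

Import Order.TTheory GRing.Theory Num.Theory.
Import numFieldNormedType.Exports.

Local Open Scope ring_scope.
Local Open Scope complex_scope.

(** ADDA as the doubling of a contractive two-port.

    Read [E_k, G_k; H_k, F_k] as a two-port: inputs (x0, y1), outputs (x1, y0),
    with x1 = E_k x0 + G_k y1 and y0 = H_k x0 + F_k y1 ([scatter]).  The ADDA
    recurrence is exactly the composition of this two-port with itself
    ([scatter_compose], [scatter_split]).

    For k = 0 the two-port solves the linear system [cayley], whose off-diagonal
    entries come from Q and whose diagonal entries are Q_ii shifted by the
    parameters.  Put a = omega(alpha), b = omega(beta).  Since omega(z) <= |z|,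
    the parameter condition for row i <= n gives
      a |Q_ii - beta| + (a + b) q_i < b |Q_ii + alpha|,
    and symmetrically for i > n ([adda_parameter_dominance]).  Hence, in the sup
    norm, with the x0, y0 side measured in units of a and the x1, y1 side in
    units of b, the outputs are at most th < 1 times the largest signal
    ([cayley_bound]).  So whenever |y1| <= |x1|, one has
    |x1| <= (th b / a) |x0| and |y0| <= |x0| ([cayley_cone]).  This cone property
    composes with itself and squares its factor at each doubling step
    ([cone_contracting_double]); it also forces G and H to shrink every nonzero
    vector, so I - G H and I - H G are invertible ([doubling_unit]).  Exchanging
    the two sides gives the dual property, with the factor th a / b.

    If X solves the Riccati equation and D - C X + alpha is invertible, the
    start two-port sends the graph {(x, X x)} to itself ([riccati_cayley]), and
    so do all its doublings.  The output H_k x0 then differs from X x0 by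
    F_k X x1, with |x1| <= (th b / a)^(2^k) |x0| and
    |F_k| <= (th a / b)^(2^k), provided that |X| <= 1.  Hence
    |(H_k - X) x| <= th^(2 2^k) |x| ([doubling_error]), which is the quadratic
    convergence.

    The bound |X| <= 1 for the extremal solution is where its spectral condition
    enters ([extremal_solution_bound]).  Use a Cayley transform with one large
    shift in the direction w + i (1 - w) on both sides: the eigenvalues of
    D - C X go into the open unit disc, so the orbit of (x, X x) is bounded
    ([orbit_bounded]), while the diagonal dominance of Q still makes each step
    contractive.  The supremum of the norms along the orbit can then only be
    attained by the starting vector x, so |X x| <= |x|.

    The statement for G_k and Psi follows by exchanging (A, B, alpha, E, G) with
    (D, C, beta, F, H) ([adda_swap]). *)

(** * Modulus and sup norm *)

Section Modulus.
Variable R : realType.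
Implicit Types z u : R[i].

Lemma cabs0 : cabs (0 : R[i]) = 0.
Proof. exact: ComplexField.Normc.normc0. Qed.

Lemma cabs1 : cabs (1 : R[i]) = 1.
Proof. exact: ComplexField.Normc.normc1. Qed.

Lemma cabsM z u : cabs (z * u) = cabs z * cabs u.
Proof. exact: ComplexField.Normc.normcM. Qed.

Lemma cabsD z u : cabs (z + u) <= cabs z + cabs u.
Proof. exact: (@le_normcD R). Qed.

Lemma cabsN z : cabs (- z) = cabs z.
Proof. exact: (@normcN R). Qed.

Lemma cabs_ge0 z : 0 <= cabs z.
Proof. by case: z => a b; apply: sqrtr_ge0. Qed.

Lemma cabs_eq0 z : cabs z = 0 -> z = 0.
Proof. exact: ComplexField.Normc.eq0_normc. Qed.

Lemma sqr_cabs z : cabs z ^+ 2 = complex.Re z ^+ 2 + complex.Im z ^+ 2.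
Proof.
by case: z => a b; rewrite /cabs /= sqr_sqrtr // addr_ge0 // sqr_ge0.
Qed.

Lemma cabs_sum (I : Type) (r : seq I) (P : pred I) (f : I -> R[i]) :
  cabs (\sum_(i <- r | P i) f i) <= \sum_(i <- r | P i) cabs (f i).
Proof.
elim/big_rec2: _ => [|i y x _ le_xy]; first by rewrite cabs0.
by rewrite (le_trans (cabsD _ _)) // lerD2l.
Qed.

(** Convexity: a weighted mean of the real and imaginary parts is at most the
    larger of the two in absolute value. *)
Lemma omega_part_le_cabs w z : 0 <= w <= 1 -> omega_part w z <= cabs z.
Proof.
move=> /andP[w0 w1].
have sq := sqr_cabs z; have z0 := cabs_ge0 z.
have leRe : complex.Re z <= cabs z.
  have [Re0|Re0] := leP (complex.Re z) 0; first exact: le_trans z0.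
  by rewrite -(ler_sqr (ltW Re0) z0) sq lerDl sqr_ge0.
have leIm : complex.Im z <= cabs z.
  have [Im0|Im0] := leP (complex.Im z) 0; first exact: le_trans z0.
  by rewrite -(ler_sqr (ltW Im0) z0) sq lerDr sqr_ge0.
rewrite /omega_part; nra.
Qed.

Lemma omega_partD w z u : omega_part w (z + u) = omega_part w z + omega_part w u.
Proof. by case: z u => a b [c d]; rewrite /omega_part /=; ring. Qed.

Lemma omega_partN w z : omega_part w (- z) = - omega_part w z.
Proof. by case: z => a b; rewrite /omega_part /=; ring. Qed.

End Modulus.

Section SupNorm.
Variable R : realType.

Definition supnorm (p : nat) (x : 'cV[R[i]]_p) : R :=
  \big[Num.max/0]_(i < p) cabs (x i 0).

Lemma supnorm_ge p (x : 'cV[R[i]]_p) i : cabs (x i 0) <= supnorm x.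
Proof. exact: (le_bigmax_cond _ (fun i => cabs (x i 0))). Qed.

Lemma supnorm_ge0 p (x : 'cV[R[i]]_p) : 0 <= supnorm x.
Proof. exact: bigmax_ge_id. Qed.

Lemma supnorm_le p (x : 'cV[R[i]]_p) c :
  0 <= c -> (forall i, cabs (x i 0) <= c) -> supnorm x <= c.
Proof. by move=> c0 xc; apply: bigmax_le. Qed.

Lemma supnorm0 p : supnorm (0 : 'cV[R[i]]_p) = 0.
Proof.
apply/eqP; rewrite eq_le supnorm_ge0 andbT; apply: supnorm_le => // i.
by rewrite mxE cabs0.
Qed.

Lemma supnorm_eq0 p (x : 'cV[R[i]]_p) : supnorm x <= 0 -> x = 0.
Proof.
move=> x0; apply/matrixP => i j; rewrite ord1 mxE; apply: cabs_eq0.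
by apply/eqP; rewrite eq_le cabs_ge0 andbT (le_trans (supnorm_ge _ _)).
Qed.

Lemma supnormD p (x y : 'cV[R[i]]_p) : supnorm (x + y) <= supnorm x + supnorm y.
Proof.
apply: supnorm_le => [|i]; first by rewrite addr_ge0 // supnorm_ge0.
by rewrite mxE (le_trans (cabsD _ _)) // lerD // supnorm_ge.
Qed.

Lemma supnormZ p a (x : 'cV[R[i]]_p) : supnorm (a *: x) <= cabs a * supnorm x.
Proof.
apply: supnorm_le => [|i]; first by rewrite mulr_ge0 ?cabs_ge0 ?supnorm_ge0.
by rewrite mxE cabsM ler_wpM2l ?cabs_ge0 ?supnorm_ge.
Qed.

Lemma supnorm_mulmx p q (M : 'M[R[i]]_(p, q)) :
  exists2 c, 0 <= c & forall x, supnorm (M *m x) <= c * supnorm x.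
Proof.
have sum0 i : 0 <= \sum_j cabs (M i j) by apply: sumr_ge0 => j _; apply: cabs_ge0.
exists (\sum_i \sum_j cabs (M i j)) => [|x]; first by apply: sumr_ge0.
apply: supnorm_le => [|i]; first by rewrite mulr_ge0 ?supnorm_ge0 ?sumr_ge0.
rewrite mxE (le_trans (cabs_sum _ _ _)) //.
apply: (@le_trans _ _ ((\sum_j cabs (M i j)) * supnorm x)).
  rewrite mulr_suml ler_sum // => j _.
  by rewrite cabsM ler_wpM2l ?cabs_ge0 ?supnorm_ge.
by rewrite ler_wpM2r ?supnorm_ge0 // (bigD1 i) //= lerDl sumr_ge0.
Qed.

Lemma unitmx_inj p (M : 'M[R[i]]_p) :
  (forall x : 'cV_p, M *m x = 0 -> x = 0) -> M \in unitmx.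
Proof.
move=> injM; rewrite -unitmx_tr -row_free_unit -kermx_eq0.
apply/eqP/row_matrixP => i; rewrite row0.
have /(congr1 trmx) : row i (kermx M^T) *m M^T = 0.
  by rewrite -row_mul mulmx_ker row0.
rewrite trmx_mul trmxK trmx0 => /injM /(congr1 trmx).
by rewrite trmxK trmx0.
Qed.

End SupNorm.

(** * Scattering relations and their doubling *)

Section Scattering.
Variable R : realType.

(** [E, G; H, F] read as a two-port: it sends the incoming pair (x0, y1) to
    the outgoing pair (x1, y0).  The doubling step is the composition of such a
    two-port with itself along the interface (x1, y1). *)
Definition scatter n m (E : 'M[R[i]]_n) (F : 'M[R[i]]_m)
    (G : 'M[R[i]]_(n, m)) (H : 'M[R[i]]_(m, n))
    (x0 : 'cV[R[i]]_n) (y0 : 'cV[R[i]]_m)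
    (x1 : 'cV[R[i]]_n) (y1 : 'cV[R[i]]_m) : Prop :=
  x1 = E *m x0 + G *m y1 /\ y0 = H *m x0 + F *m y1.

(** The cone of pairs with y no larger than x is pulled back into itself, and x
    shrinks at least by the factor e.  Both parts survive composition, with the
    factors multiplying: this is where squaring at each step comes from. *)
Definition cone_contracting n m (E : 'M[R[i]]_n) (F : 'M[R[i]]_m)
    (G : 'M[R[i]]_(n, m)) (H : 'M[R[i]]_(m, n)) (e : R) : Prop :=
  forall x0 y0 x1 y1, scatter E F G H x0 y0 x1 y1 ->
    supnorm y1 <= supnorm x1 ->
    supnorm x1 <= e * supnorm x0 /\ supnorm y0 <= supnorm x0.

(** A vector with G y at least as large as y would be the y-part of a cone pair
    coming from x0 = 0. *)
Lemma cone_contracting_lt n m (E : 'M[R[i]]_n) (F : 'M[R[i]]_m) G H e y :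
  cone_contracting E F G H e -> y != 0 -> supnorm (G *m y) < supnorm y.
Proof.
move=> cE y0; rewrite ltNge; apply/negP => le_y.
have /cE/(_ le_y)[] : scatter E F G H 0 (F *m y) (G *m y) y.
  by split; rewrite mulmx0 add0r.
rewrite supnorm0 mulr0 => Gy _; case/eqP: y0.
by apply: supnorm_eq0; apply: le_trans Gy.
Qed.

Lemma doubling_unit n m (E : 'M[R[i]]_n) (F : 'M[R[i]]_m) G H e f :
  cone_contracting E F G H e -> cone_contracting F E H G f ->
  1%:M - G *m H \in unitmx.
Proof.
move=> cE cF; apply: unitmx_inj => v.
rewrite mulmxBl mul1mx => /eqP; rewrite subr_eq0 => /eqP vGH.
have [//|v0] := eqVneq v 0.
have Hv0 : H *m v != 0.
  by apply: contraNneq v0 => Hv0; rewrite vGH -mulmxA Hv0 mulmx0.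
have := lt_trans (cone_contracting_lt cE Hv0) (cone_contracting_lt cF v0).
by rewrite mulmxA -vGH ltxx.
Qed.

(** Closing the loop formed by the two reflections K and L at an interface. *)
Lemma feedback p q (K : 'M[R[i]]_(p, q)) (L : 'M[R[i]]_(q, p)) (x a : 'cV_p) :
  1%:M - K *m L \in unitmx ->
  x = invmx (1%:M - K *m L) *m a <-> x = a + K *m (L *m x).
Proof.
move=> uKL; have eqKL : (1%:M - K *m L) *m x = x - K *m (L *m x).
  by rewrite mulmxBl mul1mx mulmxA.
split=> [xE|/eqP].
  by move: eqKL; rewrite {1}xE mulKVmx // => ->; rewrite subrK.
by rewrite -subr_eq -eqKL => /eqP <-; rewrite mulKmx.
Qed.

Section Doubling.
Variables (n m : nat) (E : 'M[R[i]]_n) (F : 'M[R[i]]_m).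
Variables (G : 'M[R[i]]_(n, m)) (H : 'M[R[i]]_(m, n)).
Hypotheses (uGH : 1%:M - G *m H \in unitmx) (uHG : 1%:M - H *m G \in unitmx).

Let E' := E *m invmx (1%:M - G *m H) *m E.
Let F' := F *m invmx (1%:M - H *m G) *m F.
Let G' := G + E *m invmx (1%:M - G *m H) *m G *m F.
Let H' := H + F *m invmx (1%:M - H *m G) *m H *m E.

Lemma scatter_compose x0 y0 x1 y1 x2 y2 :
  scatter E F G H x0 y0 x1 y1 -> scatter E F G H x1 y1 x2 y2 ->
  scatter E' F' G' H' x0 y0 x2 y2.
Proof.
move=> [ex1 ey0] [ex2 ey1].
have /(feedback _ _ uGH) fx1 : x1 = (E *m x0 + G *m (F *m y2)) + G *m (H *m x1).
  by rewrite {1}ex1 {1}ey1 mulmxDr -addrA [G *m (H *m _) + _]addrC.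
have /(feedback _ _ uHG) fy1 : y1 = (H *m (E *m x0) + F *m y2) + H *m (G *m y1).
  by rewrite {1}ey1 {1}ex1 mulmxDr addrAC.
split.
  rewrite ex2 fx1 /E' /G' !mulmxDr mulmxDl !mulmxA -!addrA; congr (_ + _).
  by rewrite addrC.
by rewrite ey0 fy1 /F' /H' !mulmxDr mulmxDl !mulmxA -!addrA.
Qed.

Lemma scatter_split x0 y0 x2 y2 : scatter E' F' G' H' x0 y0 x2 y2 ->
  exists x1 y1, scatter E F G H x0 y0 x1 y1 /\ scatter E F G H x1 y1 x2 y2.
Proof.
move=> [ex2 ey0].
pose x1 := invmx (1%:M - G *m H) *m (E *m x0 + G *m (F *m y2)).
pose y1 := H *m x1 + F *m y2.
have ex1 : x1 = E *m x0 + G *m y1.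
  rewrite {1}((feedback _ _ uGH).1 (erefl x1)) /y1 mulmxDr -!addrA.
  by rewrite [G *m (F *m _) + _]addrC.
have S01 : scatter E F G H x0 (H *m x0 + F *m y1) x1 y1 by split.
have S12 : scatter E F G H x1 y1 (E *m x1 + G *m y2) y2 by split.
have [eqx eqy] := scatter_compose S01 S12.
by exists x1, y1; rewrite ex2 ey0 -eqx -eqy.
Qed.

Lemma cone_contracting_double e : 0 <= e ->
  cone_contracting E F G H e -> cone_contracting E' F' G' H' (e ^+ 2).
Proof.
move=> e0 cE x0 y0 x2 y2 /scatter_split[x1 [y1 [S01 S12]]] le2.
have [le_x2 le1] := cE _ _ _ _ S12 le2.
have [le_x1 le0] := cE _ _ _ _ S01 le1.
by split=> //; rewrite (le_trans le_x2) // expr2 -mulrA ler_wpM2l.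
Qed.

End Doubling.
End Scattering.

(** * The Cayley relation of the Riccati equation *)

Section Cayley.
Variable R : realType.

(** The ADDA starting point is the two-port solved from these equations; along
    the graph of a solution X they describe the generalized Cayley transform
    x1 = (D - C X - be) (D - C X + al)^-1 x0. *)
Definition cayley n m (A : 'M[R[i]]_m) (B : 'M[R[i]]_(m, n))
    (C : 'M[R[i]]_(n, m)) (D : 'M[R[i]]_n) (al be : R[i])
    (x0 : 'cV[R[i]]_n) (y0 : 'cV[R[i]]_m)
    (x1 : 'cV[R[i]]_n) (y1 : 'cV[R[i]]_m) : Prop :=
  (D + al%:M) *m x1 + C *m y0 = (D - be%:M) *m x0 + C *m y1 /\
  B *m x1 + (A + be%:M) *m y0 = B *m x0 + (A - al%:M) *m y1.

Lemma cayley_swap n m (A : 'M[R[i]]_m) (B : 'M[R[i]]_(m, n)) C (D : 'M[R[i]]_n) al be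
    x0 y0 x1 y1 :
  cayley A B C D al be x0 y0 x1 y1 -> cayley D C B A be al y1 x1 y0 x0.
Proof. by case=> e1 e2; split; rewrite addrC ?e1 ?e2 addrC. Qed.

(** Writing r = D - C X, the equation says that X r v = B v - A X v, and both block
    rows reduce to (r + al) (r - be) u = (r - be) (r + al) u. *)
Lemma riccati_cayley n m (A : 'M[R[i]]_m) (B : 'M[R[i]]_(m, n)) C (D : 'M[R[i]]_n) al be
    (X : 'M[R[i]]_(m, n)) (u : 'cV_n) :
  X *m C *m X - X *m D - A *m X + B = 0 ->
  let x0 := (D - C *m X + al%:M) *m u in
  let x1 := (D - C *m X - be%:M) *m u in
  cayley A B C D al be x0 (X *m x0) x1 (X *m x1).
Proof.
move=> ric x0 x1.
have {}ric : X *m (D - C *m X) = B - A *m X.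
  apply/eqP; rewrite -subr_eq0 -oppr_eq0 -ric mulmxBr mulmxA; apply/eqP.
  move: (X *m C *m X) (X *m D) (A *m X) => XCX XD AX.
  by apply/matrixP => i j; rewrite !mxE; ring.
pose r := D - C *m X; rewrite -/r in ric.
have Dv v : D *m v = r *m v + C *m (X *m v) by rewrite mulmxBl mulmxA subrK.
have Bv v : B *m v = X *m (r *m v) + A *m (X *m v).
  by rewrite mulmxA ric mulmxBl mulmxA subrK.
have x0E : x0 = r *m u + al *: u by rewrite /x0 mulmxDl mul_scalar_mx.
have x1E : x1 = r *m u - be *: u by rewrite /x1 mulmxBl mul_scalar_mx.
clearbody r x0 x1; rewrite /cayley !(mulmxDl, mulNmx) !mul_scalar_mx !Dv !Bv.
rewrite {}x0E {}x1E !(mulmxDr, mulmxN) -!scalemxAr.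
move: (r *m (r *m u)) (r *m u) => rru ru.
move: (X *m rru) (X *m ru) (X *m u) => Xrru Xru Xu.
move: (A *m Xru) (A *m Xu) (C *m Xru) (C *m Xu) => AXru AXu CXru CXu.
by split; apply/matrixP => i j; rewrite !mxE; ring.
Qed.

End Cayley.

(** * Diagonal dominance makes the Cayley relation a contraction *)

Section Dominance.
Variable R : realType.

Definition offdiag n m (D : 'M[R[i]]_n) (C : 'M[R[i]]_(n, m)) (i : 'I_n) : R :=
  \sum_(j | j != i) cabs (D i j) + \sum_j cabs (C i j).

Lemma offdiag_ge0 n m (D : 'M[R[i]]_n) (C : 'M[R[i]]_(n, m)) i :
  0 <= offdiag D C i.
Proof. by rewrite addr_ge0 // sumr_ge0 // => j _; exact: cabs_ge0. Qed.

(** In one block row of the Cayley relation every off-diagonal entry occurs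
    twice, once against a vector of size a and once against one of size b; the
    diagonal entry occurs as D i i + al on the left, D i i - be on the right. *)
Definition dominant n m (D : 'M[R[i]]_n) (C : 'M[R[i]]_(n, m)) (al be : R[i])
    (a b : R) : Prop :=
  forall i, a * cabs (D i i - be) + (a + b) * offdiag D C i
            < b * cabs (D i i + al).

Definition dominant_by th n m (D : 'M[R[i]]_n) (C : 'M[R[i]]_(n, m))
    (al be : R[i]) (a b : R) : Prop :=
  forall i, 0 < cabs (D i i + al) /\
    a * cabs (D i i - be) + (a + b) * offdiag D C i
      <= th * (b * cabs (D i i + al)).

Lemma uniform_ratio p (u v : 'I_p -> R) :
  (forall i, 0 <= u i < v i) ->
  exists2 th, 0 <= th < 1 & forall i, u i <= th * v i.
Proof.
move=> uv; exists (\big[Num.max/0]_i (u i / v i)) => [|i].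
  rewrite bigmax_ge_id /=; apply: bigmax_lt => // i _.
  by have /andP[u0 lt_uv] := uv i; rewrite ltr_pdivrMr ?mul1r // (le_lt_trans u0).
have /andP[u0 lt_uv] := uv i; have v0 := le_lt_trans u0 lt_uv.
by rewrite -ler_pdivrMr // (le_bigmax_cond _ (fun i => u i / v i)).
Qed.

Lemma dominant_uniform n m (D : 'M[R[i]]_n) (C : 'M[R[i]]_(n, m)) al be a b :
  0 < a -> 0 < b -> dominant D C al be a b ->
  exists2 th, 0 <= th < 1 & dominant_by th D C al be a b.
Proof.
move=> a0 b0 dom.
have lhs0 i : 0 <= a * cabs (D i i - be) + (a + b) * offdiag D C i.
  by rewrite addr_ge0 // mulr_ge0 ?cabs_ge0 ?offdiag_ge0 ?addr_ge0 ?ltW.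
have [|th th01 thP] := @uniform_ratio n
  (fun i => a * cabs (D i i - be) + (a + b) * offdiag D C i)
  (fun i => b * cabs (D i i + al)).
  by move=> i; rewrite lhs0 /=; apply: dom.
exists th => // i; split; last exact: thP.
by have := le_lt_trans (lhs0 i) (dom i); rewrite pmulr_rgt0.
Qed.

Lemma dominant_by_weaken th th' n m (D : 'M[R[i]]_n) (C : 'M[R[i]]_(n, m))
    al be a b :
  th <= th' -> 0 < b -> dominant_by th D C al be a b ->
  dominant_by th' D C al be a b.
Proof.
move=> le_th b0 dom i; have [pos le_i] := dom i; split=> //.
by rewrite (le_trans le_i) // ler_wpM2r // mulr_ge0 // ltW.
Qed.

(** Isolating D i i + al in row i: each off-diagonal entry contributes at most
    (a + b) K times its modulus and D i i - be at most a K times its own. *)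
Lemma dominant_by_bound th n m (D : 'M[R[i]]_n) (C : 'M[R[i]]_(n, m))
    al be a b x0 y0 x1 y1 K :
  0 <= th -> 0 < a -> 0 < b -> 0 <= K ->
  dominant_by th D C al be a b ->
  (D + al%:M) *m x1 + C *m y0 = (D - be%:M) *m x0 + C *m y1 ->
  supnorm x0 <= a * K -> supnorm y0 <= a * K ->
  supnorm x1 <= b * K -> supnorm y1 <= b * K ->
  supnorm x1 <= th * (b * K).
Proof.
move=> th0 a0 b0 K0 dom eq_row x0K y0K x1K y1K.
apply: supnorm_le => [|i]; first by rewrite !mulr_ge0 // ltW.
have [pos dom_i] := dom i.
have row_i : (D i i + al) * x1 i 0 = (D i i - be) * x0 i 0
    + \sum_(j | j != i) D i j * (x0 j 0 - x1 j 0)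
    + \sum_j C i j * (y1 j 0 - y0 j 0).
  have sumB k (P : pred 'I_k) (f g h : 'I_k -> R[i]) :
      \sum_(j | P j) f j * (g j - h j)
      = \sum_(j | P j) f j * g j - \sum_(j | P j) f j * h j.
    by rewrite -sumrB; apply: eq_bigr => j _; rewrite mulrBr.
  have /matrixP/(_ i 0) := eq_row; rewrite mulmxDl mulmxBl !mul_scalar_mx !mxE.
  rewrite (bigD1 i) //= [\sum_(j < n) D i j * x0 j 0](bigD1 i) //= !sumB.
  move: (\sum_(j < n | j != i) D i j * x1 j 0) => s1.
  move: (\sum_(j < n | j != i) D i j * x0 j 0) => s0.
  move: (\sum_(j < m) C i j * y1 j 0) (\sum_(j < m) C i j * y0 j 0) => t1 t0.
  move: (D i i) (x1 i 0) (x0 i 0) => d v1 v0 row_i.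
  suff -> : (d + al) * v1 = (d * v1 + s1 + al * v1 + t0) - s1 - t0.
    by rewrite row_i; ring.
  by ring.
have cabsB (z u : R[i]) (s t : R) : cabs z <= s -> cabs u <= t ->
    cabs (z - u) <= s + t.
  by move=> zs ut; rewrite (le_trans (cabsD _ _)) // cabsN lerD.
have : cabs ((D i i + al) * x1 i 0) <=
    (a * cabs (D i i - be) + (a + b) * offdiag D C i) * K.
  have -> : (a * cabs (D i i - be) + (a + b) * offdiag D C i) * K
      = cabs (D i i - be) * (a * K)
        + (\sum_(j | j != i) cabs (D i j)) * (a * K + b * K)
        + (\sum_j cabs (C i j)) * (b * K + a * K) by rewrite /offdiag; ring.
  have le_x0 j := le_trans (supnorm_ge x0 j) x0K.
  have le_x1 j := le_trans (supnorm_ge x1 j) x1K.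
  have le_y0 j := le_trans (supnorm_ge y0 j) y0K.
  have le_y1 j := le_trans (supnorm_ge y1 j) y1K.
  rewrite row_i !mulr_suml (le_trans (cabsD _ _)) // lerD //.
    rewrite (le_trans (cabsD _ _)) // lerD ?cabsM ?ler_wpM2l ?cabs_ge0 //.
    rewrite (le_trans (cabs_sum _ _ _)) // ler_sum // => j _.
    by rewrite cabsM ler_wpM2l ?cabs_ge0 ?cabsB.
  rewrite (le_trans (cabs_sum _ _ _)) // ler_sum // => j _.
  by rewrite cabsM ler_wpM2l ?cabs_ge0 ?cabsB.
rewrite cabsM mulrC -ler_pdivlMr // => /le_trans; apply.
rewrite ler_pdivrMr //.
have -> : th * (b * K) * cabs (D i i + al) = th * (b * cabs (D i i + al)) * K.
  by ring.
by rewrite ler_wpM2r.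
Qed.

Lemma dominant_pair_uniform n m (A : 'M[R[i]]_m) (B : 'M[R[i]]_(m, n))
    (C : 'M[R[i]]_(n, m)) (D : 'M[R[i]]_n) al be a b :
  0 < a -> 0 < b -> dominant D C al be a b -> dominant A B be al b a ->
  exists2 th, 0 <= th < 1 &
    dominant_by th D C al be a b /\ dominant_by th A B be al b a.
Proof.
move=> a0 b0 domD domA.
have [t1 /andP[t1_ge0 t1_lt1] domD1] := dominant_uniform a0 b0 domD.
have [t2 /andP[_ t2_lt1] domA2] := dominant_uniform b0 a0 domA.
exists (Num.max t1 t2); first by rewrite le_max t1_ge0 gt_max t1_lt1 t2_lt1.
split; first by apply: dominant_by_weaken domD1; rewrite ?le_max ?lexx.
by apply: dominant_by_weaken domA2; rewrite ?le_max ?lexx ?orbT.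
Qed.

End Dominance.

Section CayleyContraction.
Variables (R : realType) (n m : nat).
Variables (A : 'M[R[i]]_m) (B : 'M[R[i]]_(m, n)).
Variables (C : 'M[R[i]]_(n, m)) (D : 'M[R[i]]_n).
Variables (al be : R[i]) (a b th : R).
Hypotheses (a0 : 0 < a) (b0 : 0 < b) (th01 : 0 <= th < 1).
Hypotheses (domD : dominant_by th D C al be a b)
           (domA : dominant_by th A B be al b a).

Let th0 : 0 <= th. Proof. by case/andP: th01. Qed.

Lemma contraction_le0 (t : R) : t <= th * t -> t <= 0.
Proof.
case/andP: th01 => _ th1; rewrite -subr_le0 -{1}[t]mul1r -mulrBl.
by rewrite pmulr_rle0 // subr_gt0.
Qed.

Lemma cayley_bound x0 y0 x1 y1 K : 0 <= K ->
  cayley A B C D al be x0 y0 x1 y1 ->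
  supnorm x0 <= a * K -> supnorm y0 <= a * K ->
  supnorm x1 <= b * K -> supnorm y1 <= b * K ->
  supnorm x1 <= th * (b * K) /\ supnorm y0 <= th * (a * K).
Proof.
move=> K0 cay x0K y0K x1K y1K; split.
  by case: cay => rowD _; apply: dominant_by_bound domD rowD _ _ _ _.
by case/cayley_swap: cay => rowA _; apply: dominant_by_bound domA rowA _ _ _ _.
Qed.

(** With the x0, y0 side measured in units of a and the x1, y1 side in units of
    b, the largest of x0, y0, x1 must be x0: the other two are at most th times
    the largest. *)
Lemma cayley_cone x0 y0 x1 y1 :
  cayley A B C D al be x0 y0 x1 y1 -> supnorm y1 <= supnorm x1 ->
  supnorm x1 <= th * (b / a) * supnorm x0 /\ supnorm y0 <= supnorm x0.
Proof.
move=> cay le1.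
pose M := Num.max (supnorm y0 / a) (supnorm x1 / b).
pose K := Num.max (supnorm x0 / a) M.
have x0K : supnorm x0 <= a * K.
  by rewrite mulrC -ler_pdivrMr // le_max lexx.
have y0K : supnorm y0 <= a * K.
  by rewrite mulrC -ler_pdivrMr // !le_max lexx orbT.
have x1K : supnorm x1 <= b * K.
  by rewrite mulrC -ler_pdivrMr // !le_max lexx !orbT.
have K0 : 0 <= K by rewrite le_max divr_ge0 ?supnorm_ge0 // ltW.
have [x1th y0th] := cayley_bound K0 cay x0K y0K x1K (le_trans le1 x1K).
have KE : K = supnorm x0 / a.
  apply/max_idPl; rewrite leNgt; apply/negP => lt_M.
  have KM : K = M by apply/max_idPr/ltW.
  have : M <= 0.
    apply: contraction_le0; rewrite -{2}KM ge_max !ler_pdivrMr //.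
    by rewrite -!mulrA ![K * _]mulrC x1th y0th.
  apply/negP; rewrite -ltNge; apply: le_lt_trans lt_M.
  by rewrite divr_ge0 ?supnorm_ge0 // ltW.
split.
  by apply: le_trans x1th _; rewrite KE le_eqVlt; apply/orP; left; apply/eqP; ring.
rewrite (le_trans y0th) // (le_trans (ler_piMl _ _)) ?KE //.
- by rewrite -KE mulr_ge0 // ltW.
- by case/andP: th01 => _ /ltW.
- by rewrite mulrCA divff ?mulr1 // gt_eqF.
Qed.

Lemma cayley_outgoing0 x1 y0 :
  cayley A B C D al be 0 y0 x1 0 -> x1 = 0 /\ y0 = 0.
Proof.
move=> /cayley_cone; rewrite !supnorm0 mulr0 => /(_ (supnorm_ge0 _))[].
by move=> /supnorm_eq0 -> /supnorm_eq0 ->.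
Qed.

Lemma shifted_diag_unit : D + al%:M \in unitmx.
Proof.
apply: unitmx_inj => x Dx0; apply: supnorm_eq0; apply: contraction_le0.
have row : (D + al%:M) *m x + C *m 0 = (D - be%:M) *m 0 + C *m 0.
  by rewrite Dx0 !mulmx0.
have bK : b * (supnorm x / b) = supnorm x by rewrite mulrCA divff ?mulr1 ?gt_eqF.
rewrite -{2}bK; apply: dominant_by_bound domD row _ _ _ _ => //.
- by rewrite divr_ge0 ?supnorm_ge0 // ltW.
- by rewrite supnorm0 mulr_ge0 ?divr_ge0 ?supnorm_ge0 // ltW.
- by rewrite supnorm0 mulr_ge0 ?divr_ge0 ?supnorm_ge0 // ltW.
- by rewrite bK.
- by rewrite supnorm0 bK supnorm_ge0.
Qed.

(** W is a Schur complement of the block system: a kernel vector v gives the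
    outgoing pair (- D_al^-1 C v, v) for zero input. *)
Lemma adda_W_unit : adda_W A B C D al be \in unitmx.
Proof.
have uD := shifted_diag_unit.
apply: unitmx_inj => v; rewrite /adda_W mulmxBl => /eqP.
rewrite subr_eq0 => /eqP Wv.
have [//|_ ->//] := @cayley_outgoing0 (- (invmx (adda_D D al) *m C *m v)) v.
split; rewrite !mulmx0 addr0 mulmxN.
  by rewrite -!mulmxA mulKVmx // addNr.
by rewrite Wv !mulmxA addNr.
Qed.

End CayleyContraction.

(** * The starting point of ADDA *)

Section AddaStart.
Variables (R : realType) (n m : nat).
Variables (A : 'M[R[i]]_m) (B : 'M[R[i]]_(m, n)).
Variables (C : 'M[R[i]]_(n, m)) (D : 'M[R[i]]_n).
Variables (al be : R[i]).

Hypotheses (uA : adda_A A be \in unitmx) (uD : adda_D D al \in unitmx).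
Hypotheses (uW : adda_W A B C D al be \in unitmx)
           (uV : adda_V A B C D al be \in unitmx).

Let iA := invmx (adda_A A be).
Let iD := invmx (adda_D D al).
Let iW := invmx (adda_W A B C D al be).
Let iV := invmx (adda_V A B C D al be).

(** Push-through identity: W A_be^-1 B and B D_al^-1 V are both
    B - B D_al^-1 C A_be^-1 B. *)
Lemma adda_push_through : iW *m B *m iD = iA *m B *m iV.
Proof.
have WV : adda_W A B C D al be *m (iA *m B) = B *m iD *m adda_V A B C D al be.
  rewrite /adda_W /adda_V mulmxBl mulmxBr !mulmxA mulmxV // mul1mx.
  by rewrite mulmxKV.
rewrite -[LHS](mulmxK uV) -[_ *m B *m iD *m _]mulmxA -[iW *m B *m _]mulmxA.
by rewrite [B *m (iD *m _)]mulmxA -WV !mulmxA mulVmx // mul1mx.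
Qed.

Definition adda_E0 := 1%:M - (al + be) *: iV.
Definition adda_F0 := 1%:M - (al + be) *: iW.
Definition adda_G0 := (al + be) *: (iD *m C *m iW).
Definition adda_H0 := (al + be) *: (iW *m B *m iD).

Lemma adda_start_cayley x0 y0 x1 y1 :
  scatter adda_E0 adda_F0 adda_G0 adda_H0 x0 y0 x1 y1 ->
  cayley A B C D al be x0 y0 x1 y1.
Proof.
have DE : adda_D D al *m adda_E0 + C *m adda_H0 = D - be%:M.
  rewrite /adda_H0 adda_push_through /adda_E0 mulmxBr mulmx1 -!scalemxAr !mulmxA.
  have -> : adda_D D al *m iV = adda_V A B C D al be *m iV + C *m iA *m B *m iV.
    by rewrite -mulmxDl subrK.
  rewrite mulmxV // scalerDr opprD addrA subrK /adda_D scalemx1.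
  by apply/matrixP => i j; rewrite !mxE; case: (i == j); rewrite ?mulr1n ?mulr0n; ring.
have BE : B *m adda_E0 + adda_A A be *m adda_H0 = B.
  rewrite /adda_H0 adda_push_through /adda_E0 mulmxBr mulmx1 -!scalemxAr !mulmxA.
  by rewrite mulmxV // mul1mx subrK.
have DG : adda_D D al *m adda_G0 + C *m adda_F0 = C.
  rewrite /adda_G0 /adda_F0 mulmxBr mulmx1 -!scalemxAr !mulmxA.
  by rewrite mulmxV // mul1mx addrC subrK.
have BG : B *m adda_G0 + adda_A A be *m adda_F0 = A - al%:M.
  rewrite /adda_G0 /adda_F0 mulmxBr mulmx1 -!scalemxAr !mulmxA.
  have -> : adda_A A be *m iW = adda_W A B C D al be *m iW + B *m iD *m C *m iW.
    by rewrite -mulmxDl subrK.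
  rewrite mulmxV // addrC scalerDr opprD addrA subrK /adda_A scalemx1.
  by apply/matrixP => i j; rewrite !mxE; case: (i == j); rewrite ?mulr1n ?mulr0n; ring.
move=> [-> ->]; split; rewrite !mulmxDr !mulmxA addrACA -!mulmxDl.
  by rewrite DE DG.
by rewrite BE BG.
Qed.

(** The block system behind the Cayley relation is nonsingular, so its solution
    is the output of the two-port. *)
Lemma cayley_adda_start x0 y0 x1 y1 :
  (forall x y, cayley A B C D al be 0 y x 0 -> x = 0 /\ y = 0) ->
  cayley A B C D al be x0 y0 x1 y1 ->
  scatter adda_E0 adda_F0 adda_G0 adda_H0 x0 y0 x1 y1.
Proof.
move=> inj [e1 e2].
pose x1' := adda_E0 *m x0 + adda_G0 *m y1.
pose y0' := adda_H0 *m x0 + adda_F0 *m y1.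
have [e1' e2'] : cayley A B C D al be x0 y0' x1' y1.
  exact: adda_start_cayley.
have [|dx dy] := inj (x1 - x1') (y0 - y0').
  split; rewrite !mulmxBr !mulmx0 addr0 addrACA -opprD.
    by rewrite e1 e1' subrr.
  by rewrite e2 e2' subrr.
by split; apply/eqP; rewrite -subr_eq0 ?dx ?dy.
Qed.

End AddaStart.

(** * Extremal solutions have sup norm at most one *)

Section Orbits.
Variable R : realType.

(** The constant c / (1 - |mu|) is the fixed point of t |-> c + |mu| t. *)
Lemma affine_recurrence_bounded (p : nat) (mu : R[i]) (f : nat -> 'cV[R[i]]_p) c :
  cabs mu < 1 -> (forall k, supnorm (f k.+1 - mu *: f k) <= c) ->
  exists c', forall k, supnorm (f k) <= c'.
Proof.
move=> mu1 fc; exists (Num.max (supnorm (f 0%N)) (c / (1 - cabs mu))) => k.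
set M := Num.max _ _; elim: k => [|k IHk]; first by rewrite le_max lexx.
rewrite -[f k.+1](subrK (mu *: f k)) (le_trans (supnormD _ _)) //.
have cM : c <= M * (1 - cabs mu).
  by rewrite -ler_pdivrMr ?subr_gt0 // le_max lexx orbT.
rewrite (le_trans (lerD (fc k) (supnormZ _ _))) //.
have : cabs mu * supnorm (f k) <= cabs mu * M by rewrite ler_wpM2l ?cabs_ge0.
lra.
Qed.

(** Cayley-Hamilton reduces boundedness of the orbit of v to scalar recurrences,
    one for each root of the characteristic polynomial. *)
Lemma orbit_bounded (p : nat) (T : 'M[R[i]]_p) (v : 'cV[R[i]]_p) :
  (forall mu, eigenvalue T mu -> cabs mu < 1) ->
  exists c, forall k, supnorm (iter k (mulmx T) v) <= c.
Proof.
case: p T v => [|p] T v eig.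
  exists 0 => k; apply: supnorm_le => // -[] //.
have [s sE] := closed_field_poly_normal (char_poly T).
rewrite (monicP (char_poly_monic T)) scale1r in sE.
have s1 mu : mu \in s -> cabs mu < 1.
  by move=> mus; apply: eig; rewrite eigenvalue_root_char sE root_prod_XsubC.
have killv : (\prod_(mu <- s) (T - mu%:M)) *m v = 0.
  have := Cayley_Hamilton T; rewrite sE rmorph_prod /= => CH.
  rewrite -[RHS](mul0mx _ v) -CH; congr (_ *m v); apply: eq_bigr => mu _.
  by rewrite rmorphB /= horner_mx_X horner_mx_C.
have {sE} : all (fun mu => cabs mu < 1) s by apply/allP.
elim/last_ind: s {s1} v killv => [|s mu IHs] v.
  rewrite big_nil mul1mx => -> _; exists 0 => k.
  by elim: k => [|k /supnorm_eq0 IHk] /=; rewrite ?IHk ?mulmx0 supnorm0.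
rewrite big_rcons /= -mulmxE -mulmxA all_rcons => killv /andP[mu1 /IHs IH].
have [c cP] := IH _ killv.
apply: (affine_recurrence_bounded (c := c) mu1) => k.
suff -> : iter k.+1 (mulmx T) v - mu *: iter k (mulmx T) v
    = iter k (mulmx T) ((T - mu%:M) *m v) by [].
have iterB j w u : iter j (mulmx T) (w - u) = iter j (mulmx T) w - iter j (mulmx T) u.
  by elim: j => //= j ->; rewrite mulmxBr.
have iterZ j w : iter j (mulmx T) (mu *: w) = mu *: iter j (mulmx T) w.
  by elim: j => //= j ->; rewrite scalemxAr.
by rewrite mulmxBl mul_scalar_mx iterB iterZ -iterSr.
Qed.

End Orbits.

Section HalfPlane.
Variable R : realType.

(** w + i (1 - w) is the inner normal of the half-plane where [omega_part w] is
    positive, so (z - ga) / (z + ga) maps that half-plane into the unit disc for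
    every positive multiple ga of it. *)
Definition shift_dir (w s : R) : R[i] := (s * w) +i* (s * (1 - w)).

Lemma sqr_cabs_shift w s (z : R[i]) :
  cabs (z + shift_dir w s) ^+ 2 - cabs (z - shift_dir w s) ^+ 2
  = 4 * s * omega_part w z.
Proof. by rewrite !sqr_cabs; case: z => u v; rewrite /omega_part /=; ring. Qed.

Lemma cabs_shift_dir_le w s : 0 <= w <= 1 -> 0 <= s -> cabs (shift_dir w s) <= s.
Proof.
move=> /andP[w0 w1] s0; rewrite -(ler_sqr (cabs_ge0 _) s0) sqr_cabs /=.
rewrite !exprMn -mulrDr ler_piMr ?sqr_ge0 //; nra.
Qed.

Lemma omega_shift_dir w s : 0 < s -> 0 < omega_part w (shift_dir w s).
Proof.
move=> s0; rewrite /omega_part /=.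
have -> : w * (s * w) + (1 - w) * (s * (1 - w)) = s * (w ^+ 2 + (1 - w) ^+ 2).
  by ring.
by rewrite mulr_gt0 //; nra.
Qed.

(** The squares of |z + ga| and |z - ga| differ by 4 s omega(z), while their sum
    is at most 2 (|z| + s): for large s the moduli differ by at least nearly
    2 omega(z). *)
Lemma shift_gap w s (z : R[i]) q : 0 <= w <= 1 -> 0 <= q < omega_part w z ->
  q * cabs z / (omega_part w z - q) < s ->
  cabs (z - shift_dir w s) + 2 * q < cabs (z + shift_dir w s).
Proof.
move=> w01 /andP[q0 qz]; rewrite ltr_pdivrMr ?subr_gt0 // => sz.
have s0 : 0 < s.
  have : 0 <= q * cabs z by rewrite mulr_ge0 ?cabs_ge0.
  move=> /le_lt_trans /(_ sz); rewrite pmulr_lgt0 // subr_gt0 //.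
have gs := cabs_shift_dir_le w01 (ltW s0).
have sq := sqr_cabs_shift w s z.
have le_p := cabsD z (shift_dir w s).
have le_m := cabsD z (- shift_dir w s); rewrite cabsN in le_m.
have p0 := cabs_ge0 (z + shift_dir w s); have m0 := cabs_ge0 (z - shift_dir w s).
move: (cabs (z + _)) (cabs (z - _)) (cabs (shift_dir _ _)) p0 m0 sq le_p le_m gs.
move=> p t g p0 t0 sq le_p le_t gs; rewrite ltNge; apply/negP => le_pt.
have : (p - t) * (p + t) <= 2 * q * (p + t).
  by rewrite ler_wpM2r ?addr_ge0 // lerBlDl.
have : 2 * q * (p + t) <= 2 * q * (2 * (cabs z + s)).
  by rewrite ler_wpM2l ?mulr_ge0 //; lra.
rewrite -subr_sqr sq; lra.
Qed.

Lemma eigenvalue_unit p (T : 'M[R[i]]_p) a :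
  ~~ eigenvalue T (- a) -> T + a%:M \in unitmx.
Proof.
rewrite /eigenvalue /eigenspace negbK kermx_eq0 row_free_unit.
by rewrite raddfN opprK.
Qed.

Lemma cayley_eigenvalue p (T : 'M[R[i]]_p) ga mu : ga != 0 ->
  T + ga%:M \in unitmx ->
  eigenvalue ((T - ga%:M) *m invmx (T + ga%:M)) mu ->
  exists2 la, eigenvalue T la & la - ga = mu * (la + ga).
Proof.
move=> ga0 uT /eigenvalueP[v vE v0].
pose u := v *m invmx (T + ga%:M).
have vu : v = u *m (T + ga%:M) by rewrite mulmxKV.
have u0 : u != 0 by apply: contraNneq v0 => u0; rewrite vu u0 mul0mx.
have comm : (T + ga%:M) *m (T - ga%:M) = (T - ga%:M) *m (T + ga%:M).
  rewrite mulmxDl !mulmxBr mulmxBl !mulmxDr !mul_scalar_mx !mul_mx_scalar.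
  move: (T *m T) (ga%:M) => TT G.
  by apply/matrixP => i j; rewrite !mxE; ring.
have uE : u *m (T - ga%:M) = mu *: (u *m (T + ga%:M)).
  by rewrite -vu -vE {1}vu -[RHS]mulmxA [(T + ga%:M) *m _]mulmxA comm mulmxK.
move: uE; rewrite mulmxBr mulmxDr !mul_mx_scalar scalerDr scalerA => uE.
have {}uE : (1 - mu) *: (u *m T) = (ga * (1 + mu)) *: u.
  rewrite scalerBl scale1r; apply/eqP; rewrite subr_eq; apply/eqP.
  rewrite mulrDr mulr1 scalerDl -addrA [ga * mu]mulrC [_ + mu *: _]addrC -uE.
  by rewrite addrC subrK.
have mu1 : 1 - mu != 0.
  apply/eqP => mu1; move: uE; rewrite mu1 scale0r => /esym/eqP.
  rewrite scaler_eq0 (negPf u0) orbF mulf_eq0 (negPf ga0) /=.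
  have -> : mu = 1 by apply/esym/eqP; rewrite -subr_eq0 mu1.
  by rewrite -[1 + 1]/(2%:R) pnatr_eq0.
exists (ga * (1 + mu) / (1 - mu)); last by field.
apply/eigenvalueP; exists u => //.
by rewrite mulrC -scalerA -uE scalerA mulVf // scale1r.
Qed.

End HalfPlane.

Section GraphBound.
Variables (R : realType) (n m : nat).
Variables (A : 'M[R[i]]_m) (B : 'M[R[i]]_(m, n)).
Variables (C : 'M[R[i]]_(n, m)) (D : 'M[R[i]]_n).

(** Take the supremum of the norms along a bounded orbit: one Cayley step
    brings every x except x 0, and every y, below th times the supremum, which
    is therefore attained at x 0. *)
Lemma cayley_orbit_bound al be th (x : nat -> 'cV[R[i]]_n) (y : nat -> 'cV[R[i]]_m) c :
  0 <= th < 1 -> dominant_by th D C al be 1 1 -> dominant_by th A B be al 1 1 ->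
  (forall k, cayley A B C D al be (x k) (y k) (x k.+1) (y k.+1)) ->
  (forall k, supnorm (x k) <= c /\ supnorm (y k) <= c) ->
  supnorm (y 0%N) <= supnorm (x 0%N).
Proof.
move=> th01 domD domA cay xyc.
pose S := [set t | exists k, t = Num.max (supnorm (x k)) (supnorm (y k))]%classic.
have hsS : has_sup S.
  split; first by exists (Num.max (supnorm (x 0%N)) (supnorm (y 0%N))), 0%N.
  by exists c => _ [k ->]; have [xc yc] := xyc k; rewrite ge_max xc yc.
have leS k : supnorm (x k) <= sup S /\ supnorm (y k) <= sup S.
  have : Num.max (supnorm (x k)) (supnorm (y k)) <= sup S.
    by apply: ub_le_sup; [case: hsS|exists k].
  by rewrite ge_max => /andP[].
have S0 : 0 <= sup S by have [/(le_trans (supnorm_ge0 _))] := leS 0%N.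
have step k : supnorm (x k.+1) <= th * sup S /\ supnorm (y k) <= th * sup S.
  have [xk yk] := leS k; have [xk1 yk1] := leS k.+1.
  have := cayley_bound ltr01 ltr01 th01 domD domA S0 (cay k).
  by rewrite !mul1r; apply.
have le_sup : sup S <= Num.max (supnorm (x 0%N)) (th * sup S).
  apply: ge_sup; first by case: hsS.
  move=> _ [k ->]; rewrite ge_max; apply/andP; split; rewrite le_max.
    by case: k => [|k]; rewrite ?lexx // (step k).1 orbT.
  by rewrite (step k).2 orbT.
have [_ y0] := leS 0%N; apply: le_trans y0 _; move: le_sup; rewrite le_max.
case/orP=> // /(contraction_le0 th01) /le_trans; apply; exact: supnorm_ge0.
Qed.

Lemma shift_dominant w : 0 <= w <= 1 ->
  (forall i, offdiag D C i < omega_part w (D i i)) ->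
  (forall i, offdiag A B i < omega_part w (A i i)) ->
  exists2 s, 0 < s &
    dominant D C (shift_dir w s) (shift_dir w s) 1 1 /\
    dominant A B (shift_dir w s) (shift_dir w s) 1 1.
Proof.
move=> w01 domD domA.
pose sD i := offdiag D C i * cabs (D i i) / (omega_part w (D i i) - offdiag D C i).
pose sA i := offdiag A B i * cabs (A i i) / (omega_part w (A i i) - offdiag A B i).
pose s := Num.max (\big[Num.max/0]_i sD i) (\big[Num.max/0]_i sA i) + 1.
exists s; first by rewrite ltr_wpDl // le_max bigmax_ge_id.
split=> i; rewrite !mul1r; apply: shift_gap => //; rewrite ?offdiag_ge0 //=.
  rewrite ltr_pwDr // le_max; apply/orP; left.
  exact: (le_bigmax_cond _ sD).
rewrite ltr_pwDr // le_max; apply/orP; right.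
exact: (le_bigmax_cond _ sA).
Qed.

(** The Cayley transform of D - C X with shift ga has spectral radius below one,
    so its orbits are bounded and [cayley_orbit_bound] applies to the graph. *)
Lemma extremal_solution_bound w (X : 'M[R[i]]_(m, n)) : 0 <= w <= 1 ->
  (forall i, offdiag D C i < omega_part w (D i i)) ->
  (forall i, offdiag A B i < omega_part w (A i i)) ->
  extremal_solution A B C D w X ->
  forall v : 'cV_n, supnorm (X *m v) <= supnorm v.
Proof.
move=> w01 offD offA [ric eigX] v.
have [s s0 [domD domA]] := shift_dominant w01 offD offA.
set ga := shift_dir w s in domD domA.
have wga : 0 < omega_part w ga by apply: omega_shift_dir.
have [th th01 [domDth domAth]] := dominant_pair_uniform ltr01 ltr01 domD domA.
pose r := D - C *m X.
have ur : r + ga%:M \in unitmx.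
  apply: eigenvalue_unit; apply/negP => /eigX.
  by rewrite omega_partN oppr_gt0 ltNge ltW.
pose T := (r - ga%:M) *m invmx (r + ga%:M).
have ga0 : ga != 0.
  by apply: contraTneq wga => ->; rewrite /omega_part /= !mulr0 addr0 ltxx.
have eigT mu : eigenvalue T mu -> cabs mu < 1.
  move=> /(cayley_eigenvalue ga0 ur)[la /eigX la0 laE].
  have : cabs (la - ga) ^+ 2 < cabs (la + ga) ^+ 2.
    by rewrite -subr_gt0 sqr_cabs_shift !mulr_gt0.
  rewrite ltr_sqr ?nnegrE ?cabs_ge0 // laE cabsM => lt_mu.
  have p0 : 0 < cabs (la + ga).
    by apply: le_lt_trans lt_mu; rewrite mulr_ge0 ?cabs_ge0.
  by move: lt_mu; rewrite gtr_pMl.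
have [c cP] := orbit_bounded v eigT.
have [c' c'0 c'P] := supnorm_mulmx X.
pose x k := iter k (mulmx T) v.
apply: (@cayley_orbit_bound ga ga th x (fun k => X *m x k) (c + c' * c)) => // k.
  have -> : x k = (r + ga%:M) *m (invmx (r + ga%:M) *m x k) by rewrite mulKVmx.
  have -> : x k.+1 = (r - ga%:M) *m (invmx (r + ga%:M) *m x k).
    by rewrite mulmxA.
  exact: riccati_cayley.
have c0 : 0 <= c by rewrite (le_trans (supnorm_ge0 _) (cP 0%N)).
split; first by rewrite (le_trans (cP k)) // lerDl mulr_ge0.
by rewrite (le_trans (c'P _)) // -[X in X <= _]add0r lerD // ler_wpM2l // cP.
Qed.

End GraphBound.

(** * From a doubly exponential bound to the limit superior *)

Section QuadraticConvergence.
Variable R : realType.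

Lemma matrix_norm_le (p q : nat) (N : 'M[R[i]]_(p, q) -> R) :
  is_matrix_norm N ->
  exists2 K, 0 <= K & forall (M : 'M[R[i]]_(p, q)) c,
    (forall i j, cabs (M i j) <= c) -> N M <= c * K.
Proof.
move=> [N0 _ NZ ND]; have Nz : N 0 = 0.
  by rewrite -(scale0r 0) NZ cabs0 mul0r.
have Nsum (I : Type) (r : seq I) (g : I -> 'M[R[i]]_(p, q)) :
    N (\sum_(i <- r) g i) <= \sum_(i <- r) N (g i).
  elim/big_rec2: _ => [|i y x _ le_xy]; first by rewrite Nz.
  by rewrite (le_trans (ND _ _)) // lerD2l.
exists (\sum_i \sum_j N (delta_mx i j)) => [|M c Mc].
  by apply: sumr_ge0 => i _; apply: sumr_ge0.
rewrite {1}[M]matrix_sum_delta mulr_sumr (le_trans (Nsum _ _ _)) // ler_sum // => i _.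
rewrite mulr_sumr (le_trans (Nsum _ _ _)) // ler_sum // => j _.
by rewrite NZ ler_wpM2r.
Qed.

Lemma limn_esup_le_near (u : (\bar R)^nat) (l : \bar R) :
  (\forall k \near \oo, u k <= l)%E%classic -> (limn_esup u <= l)%E.
Proof.
move=> ul; rewrite /limn_esup /limf_esup.
have inS : [set ereal_sup (u @` V) | V in \oo]%classic
    (ereal_sup (u @` [set k | u k <= l]%E)%classic).
  by exists [set k | u k <= l]%E%classic.
apply: le_trans (ereal_inf_lbound inS) _.
by apply: ge_ereal_sup => _ [k /= le_k <-].
Qed.

(** The constant K disappears in the 2^k-th root: raising r slightly to s < 1,
    K r^N is eventually below s^N. *)
Lemma quadratic_cvg_geometric (p q : nat) (X : nat -> 'M[R[i]]_(p, q)) L r :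
  0 <= r < 1 -> (forall k i j, cabs ((X k - L) i j) <= r ^+ (2 ^ k)) ->
  quadratic_cvg X L.
Proof.
move=> /andP[r0 r1] XL N normN; have [N0 _ _ _] := normN.
have [K K0 NK] := matrix_norm_le normN.
pose s := (r + 1) / 2.
have s0 : 0 < s by rewrite /s; lra.
have rs : r / s < 1 by rewrite ltr_pdivrMr // mul1r /s; lra.
have s1 : s < 1 by rewrite /s; lra.
apply: (@le_lt_trans _ _ s%:E); last by rewrite lte_fin.
apply: limn_esup_le_near.
have cvg0 : ((GRing.exp (r / s) : R^nat) @ \oo --> (0 : R))%classic.
  by apply: cvg_expr; rewrite ger0_norm // divr_ge0 // ltW.
have K1 : 0 < (K + 1)^-1 by rewrite invr_gt0 ltr_wpDl.
have [n0 _ n0P] := cvgr_lt _ cvg0 _ K1.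
exists n0 => // k /= le_k; rewrite lee_fin.
have /n0P /= : (n0 <= 2 ^ k)%N by rewrite (leq_trans le_k) // ltnW // ltn_expl.
rewrite expr_div_n ltr_pdivrMr ?exprn_gt0 // => lt_r.
have le_N : N (X k - L) <= s ^+ (2 ^ k).
  apply: le_trans (NK _ _ (XL k)) _.
  apply: (@le_trans _ _ ((K + 1)^-1 * s ^+ (2 ^ k) * (K + 1))).
    apply: ler_pM; rewrite ?exprn_ge0 ?lerDl //; exact: ltW.
  by rewrite mulrAC mulVf ?mul1r // gt_eqF // ltr_wpDl.
have root0 : 0 <= 1 / 2 ^+ k :> R by rewrite divr_ge0 // exprn_ge0.
apply: le_trans (ge0_ler_powR root0 _ _ le_N) _.
- by rewrite nnegrE.
- by rewrite nnegrE exprn_ge0 // ltW.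
rewrite -(powR_mulrn _ (ltW s0)) -powRrM natrX mul1r divff ?expf_neq0 //.
by rewrite powRr1 // ltW.
Qed.

End QuadraticConvergence.

(** * Convergence of the doubling iteration *)

Section DoublingConvergence.
Variables (R : realType) (n m : nat).
Variables (E : nat -> 'M[R[i]]_n) (F : nat -> 'M[R[i]]_m).
Variables (G : nat -> 'M[R[i]]_(n, m)) (H : nat -> 'M[R[i]]_(m, n)).

Definition doubling_steps := forall k : nat,
  [/\ E k.+1 = E k *m invmx (1%:M - G k *m H k) *m E k,
      F k.+1 = F k *m invmx (1%:M - H k *m G k) *m F k,
      G k.+1 = G k + E k *m invmx (1%:M - G k *m H k) *m G k *m F k &
      H k.+1 = H k + F k *m invmx (1%:M - H k *m G k) *m H k *m E k].

Variables (e f : R).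
Hypotheses (e0 : 0 <= e) (f0 : 0 <= f) (steps : doubling_steps).
Hypotheses (cone0 : cone_contracting (E 0%N) (F 0%N) (G 0%N) (H 0%N) e)
           (dual_cone0 : cone_contracting (F 0%N) (E 0%N) (H 0%N) (G 0%N) f).

Lemma doubling_cones k :
  cone_contracting (E k) (F k) (G k) (H k) (e ^+ (2 ^ k)) /\
  cone_contracting (F k) (E k) (H k) (G k) (f ^+ (2 ^ k)).
Proof.
elim: k => [|k [cE cF]]; first by rewrite !expr1.
have [-> -> -> ->] := steps k.
have uGH := doubling_unit cE cF; have uHG := doubling_unit cF cE.
by rewrite expnSr !exprM; split; apply: cone_contracting_double;
   rewrite // exprn_ge0.
Qed.

Lemma doubling_units k :
  (1%:M - G k *m H k \in unitmx) /\ (1%:M - H k *m G k \in unitmx).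
Proof.
by have [cE cF] := doubling_cones k; split; [apply: doubling_unit cE cF|
  apply: doubling_unit cF cE].
Qed.

Variable X : 'M[R[i]]_(m, n).
Hypothesis graph0 : forall x0, exists x1,
  scatter (E 0%N) (F 0%N) (G 0%N) (H 0%N) x0 (X *m x0) x1 (X *m x1).
Hypothesis X1 : forall v : 'cV_n, supnorm (X *m v) <= supnorm v.

Lemma doubling_graph k x0 : exists x1,
  scatter (E k) (F k) (G k) (H k) x0 (X *m x0) x1 (X *m x1).
Proof.
elim: k x0 => [|k IHk] x0 //.
have [-> -> -> ->] := steps k; have [uGH uHG] := doubling_units k.
have [x1 S01] := IHk x0; have [x2 S12] := IHk x1.
by exists x2; apply: scatter_compose S01 S12.
Qed.

(** On the graph of X the output H x0 misses X x0 by F X x1; both x1 and F are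
    small. *)
Lemma doubling_error k (x0 : 'cV_n) :
  supnorm ((H k - X) *m x0) <= (e * f) ^+ (2 ^ k) * supnorm x0.
Proof.
have [cE cF] := doubling_cones k; have [x1 S01] := doubling_graph k x0.
have [x1e _] := cE _ _ _ _ S01 (X1 _).
have [_ Xx0] := S01.
have -> : (H k - X) *m x0 = - 1 *: (F k *m (X *m x1)).
  by rewrite mulmxBl Xx0 opprD addrA subrr add0r scaleN1r.
have Fy (y : 'cV_m) : supnorm (F k *m y) <= f ^+ (2 ^ k) * supnorm y.
  have S : scatter (F k) (E k) (H k) (G k) y (G k *m y) (F k *m y) 0.
    by split; rewrite mulmx0 addr0.
  have [|leF _] := cF _ _ _ _ S; last exact: leF.
  by rewrite supnorm0 supnorm_ge0.
rewrite (le_trans (supnormZ _ _)) // cabsN cabs1 mul1r (le_trans (Fy _)) //.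
rewrite exprMn [e ^+ _ * _]mulrC -mulrA ler_wpM2l ?exprn_ge0 //.
by rewrite (le_trans (X1 _)).
Qed.

Lemma doubling_quadratic_cvg : e * f < 1 -> quadratic_cvg H X.
Proof.
move=> ef1; apply: (@quadratic_cvg_geometric _ _ _ _ _ (e * f)).
  by rewrite mulr_ge0.
move=> k i j; pose d : 'cV[R[i]]_n := delta_mx j 0.
have -> : (H k - X) i j = ((H k - X) *m d) i 0 by rewrite -colE [RHS]mxE.
rewrite (le_trans (supnorm_ge _ _)) // (le_trans (doubling_error _ _)) //.
rewrite ler_piMr ?exprn_ge0 ?mulr_ge0 //; apply: supnorm_le => // l.
by rewrite mxE; case: andP => _; rewrite ?cabs1 ?cabs0.
Qed.

End DoublingConvergence.

Section Adda.
Variable R : realType.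

Lemma adda_swap n m (A : 'M[R[i]]_m) (B : 'M[R[i]]_(m, n))
    (C : 'M[R[i]]_(n, m)) (D : 'M[R[i]]_n) (al be : R[i]) E F G H :
  adda_A A be \in unitmx -> adda_D D al \in unitmx ->
  adda_W A B C D al be \in unitmx -> adda_V A B C D al be \in unitmx ->
  adda_sequences A B C D al be E F G H -> adda_sequences D C B A be al F E H G.
Proof.
move=> uA uD uW uV [[E0 F0 G0 H0] steps].
split; last by move=> k; have [] := steps k.
have VW : adda_V D C B A be al = adda_W A B C D al be by [].
have WV : adda_W D C B A be al = adda_V A B C D al be by [].
have H0_swap := adda_push_through uA uD uW uV.
rewrite VW WV [be + al]addrC; split.
- exact: F0.
- exact: E0.
- by rewrite H0 H0_swap.
- rewrite G0; congr (_ *: _); symmetry.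
  by apply: (@adda_push_through _ _ _ D C B A be al).
Qed.

Variables (w : R) (al be : R[i]).
Hypotheses (w01 : 0 <= w <= 1).
Let a := omega_part w al.
Let b := omega_part w be.
Hypotheses (a0 : 0 < a) (b0 : 0 < b).

(** |be - z| + |al + z| is at least |al + be|, hence at least a + b. *)
Lemma adda_parameter_dominance z q : 0 <= q -> q < omega_part w z ->
  (a + q) / cabs (al + z) * cabs (be - z) < b - q ->
  a * cabs (z - be) + (a + b) * q < b * cabs (z + al).
Proof.
move=> q0 qz; have p0 : 0 < cabs (al + z).
  apply: lt_le_trans (omega_part_le_cabs _ w01).
  by rewrite omega_partD addr_gt0 // (le_lt_trans q0).
rewrite mulrAC ltr_pdivrMr // => lt_ab.
have ab : a + b <= cabs (be - z) + cabs (al + z).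
  rewrite -omega_partD (le_trans (omega_part_le_cabs _ w01)) //.
  have -> : al + be = (be - z) + (al + z) by ring.
  exact: cabsD.
have := ler_wpM2l q0 ab; rewrite -(cabsN (z - be)) opprB [z + al]addrC; lra.
Qed.


Variables (n m : nat) (A : 'M[R[i]]_m) (B : 'M[R[i]]_(m, n)).
Variables (C : 'M[R[i]]_(n, m)) (D : 'M[R[i]]_n).
Variables (E : nat -> 'M[R[i]]_n) (F : nat -> 'M[R[i]]_m).
Variables (G : nat -> 'M[R[i]]_(n, m)) (H : nat -> 'M[R[i]]_(m, n)).
Variable th : R.
Hypothesis th01 : 0 <= th < 1.
Hypotheses (domD : dominant_by th D C al be a b)
           (domA : dominant_by th A B be al b a).

Lemma adda_start_units :
  [/\ adda_A A be \in unitmx, adda_D D al \in unitmx,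
      adda_W A B C D al be \in unitmx & adda_V A B C D al be \in unitmx].
Proof.
split.
- exact: shifted_diag_unit b0 a0 th01 domA.
- exact: shifted_diag_unit a0 b0 th01 domD.
- exact: adda_W_unit a0 b0 th01 domD domA.
- exact: adda_W_unit b0 a0 th01 domA domD.
Qed.

Hypothesis seqs : adda_sequences A B C D al be E F G H.

Lemma adda_start_cone :
  cone_contracting (E 0%N) (F 0%N) (G 0%N) (H 0%N) (th * (b / a)).
Proof.
have [uA uD uW uV] := adda_start_units; have [[-> -> -> ->] _] := seqs.
move=> x0 y0 x1 y1 /(adda_start_cayley uA uD uW uV).
exact: cayley_cone.
Qed.

(** On the graph of the solution X the starting two-port acts as the Cayley
    transform of D - C X. *)
Lemma adda_start_graph X x0 : extremal_solution A B C D w X ->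
  exists x1, scatter (E 0%N) (F 0%N) (G 0%N) (H 0%N) x0 (X *m x0) x1 (X *m x1).
Proof.
move=> [ric eigX].
have [uA uD uW uV] := adda_start_units; have [[-> -> -> ->] _] := seqs.
have ur : D - C *m X + al%:M \in unitmx.
  apply: eigenvalue_unit; apply/negP => /eigX.
  by rewrite omega_partN oppr_gt0 ltNge ltW.
exists ((D - C *m X - be%:M) *m (invmx (D - C *m X + al%:M) *m x0)).
apply: (cayley_adda_start uA uD uW uV).
  exact: cayley_outgoing0 a0 b0 th01 domD domA.
rewrite -[in X in cayley _ _ _ _ _ _ X](mulKVmx ur x0).
by rewrite -{2}(mulKVmx ur x0); apply: riccati_cayley.
Qed.

End Adda.

(** The two contraction factors th b / a and th a / b need not both be below one;
    the error involves only their product th^2. *)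
Lemma adda_converges (R : realType) n m (w : R) (al be : R[i])
    (A : 'M[R[i]]_m) (B : 'M[R[i]]_(m, n)) (C : 'M[R[i]]_(n, m)) (D : 'M[R[i]]_n)
    E F G H X th :
  0 <= w <= 1 -> 0 < omega_part w al -> 0 < omega_part w be -> 0 <= th < 1 ->
  dominant_by th D C al be (omega_part w al) (omega_part w be) ->
  dominant_by th A B be al (omega_part w be) (omega_part w al) ->
  (forall i, offdiag D C i < omega_part w (D i i)) ->
  (forall i, offdiag A B i < omega_part w (A i i)) ->
  adda_sequences A B C D al be E F G H -> extremal_solution A B C D w X ->
  adda_well_defined A B C D al be G H /\ quadratic_cvg H X.
Proof.
move=> w01 a0 b0 th01 domD domA offD offA seqs solX.
have [th0 th1] := andP th01.
have [uA uD uW uV] := adda_start_units a0 b0 th01 domD domA.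
have seqs' := adda_swap uA uD uW uV seqs.
have cE := adda_start_cone a0 b0 th01 domD domA seqs.
have cF := adda_start_cone b0 a0 th01 domA domD seqs'.
set a := omega_part w al in a0 domD domA cE cF.
set b := omega_part w be in b0 domD domA cE cF.
have e0 : 0 <= th * (b / a) by rewrite mulr_ge0 ?divr_ge0 // ltW.
have f0 : 0 <= th * (a / b) by rewrite mulr_ge0 ?divr_ge0 // ltW.
have [_ steps] := seqs.
split; first by split=> // k; apply: doubling_units e0 f0 steps cE cF k.
apply: (doubling_quadratic_cvg e0 f0 steps cE cF).
- by move=> x0; apply: (adda_start_graph a0 b0 th01 domD domA seqs).
- exact: extremal_solution_bound w01 offD offA solX.
have -> : th * (b / a) * (th * (a / b)) = th * th.
  by field; rewrite !gt_eqF.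
by rewrite mulr_ilt1.
Qed.

Lemma nare_offdiag_left (R : realType) n m (A : 'M[R[i]]_m) (B : 'M[R[i]]_(m, n))
    (C : 'M[R[i]]_(n, m)) (D : 'M[R[i]]_n) (i : 'I_n) :
  \sum_(j | j != lshift m i) cabs (nare_mx A B C D (lshift m i) j)
  = offdiag D C i.
Proof.
rewrite big_split_ord /=; congr (_ + _).
  by apply: eq_big => [j|j _]; rewrite ?(inj_eq (@lshift_inj _ _)) ?block_mxEul.
apply: eq_big => [j|j _]; first by rewrite eq_rlshift.
by rewrite block_mxEur mxE cabsN.
Qed.

Lemma nare_offdiag_right (R : realType) n m (A : 'M[R[i]]_m) (B : 'M[R[i]]_(m, n))
    (C : 'M[R[i]]_(n, m)) (D : 'M[R[i]]_n) (i : 'I_m) :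
  \sum_(j | j != rshift n i) cabs (nare_mx A B C D (rshift n i) j)
  = offdiag A B i.
Proof.
rewrite big_split_ord /= addrC; congr (_ + _).
  by apply: eq_big => [j|j _]; rewrite ?(inj_eq (@rshift_inj _ _)) ?block_mxEdr.
apply: eq_big => [j|j _]; first by rewrite eq_lrshift.
by rewrite block_mxEdl mxE cabsN.
Qed.

Lemma omega_comparison_row_sum (R : realType) p (w : R) (M : 'M[R[i]]_p) i :
  (omega_comparison w M *m (const_mx 1 : 'cV[R]_p)) i 0
  = omega_part w (M i i) - \sum_(j | j != i) cabs (M i j).
Proof.
rewrite mxE (bigD1 i) //= !mxE eqxx mulr1 -sumrN; congr (_ + _).
by apply: eq_bigr => j ji; rewrite !mxE eq_sym (negPf ji) mulr1.
Qed.

Theorem theorem6p2 (R : realType) (m n : nat) (w : R)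
    (A : 'M[R[i]]_m) (B : 'M[R[i]]_(m, n))
    (C : 'M[R[i]]_(n, m)) (D : 'M[R[i]]_n)
    (alpha beta : R[i])
    (Phi : 'M[R[i]]_(m, n)) (Psi : 'M[R[i]]_(n, m))
    (E : nat -> 'M[R[i]]_n) (F : nat -> 'M[R[i]]_m)
    (G : nat -> 'M[R[i]]_(n, m)) (H : nat -> 'M[R[i]]_(m, n)) :
  let Q := nare_mx A B C D in
  let q := fun i : 'I_(n + m) => \sum_(j | j != i) cabs (Q i j) in
  0 <= w <= 1 ->
  class_H A B C D w ->
  mx_pos (omega_comparison w Q *m (const_mx 1 : 'cV[R]_(n + m))) ->
  extremal_solution A B C D w Phi ->
  extremal_solution D C B A w Psi ->
  0 < omega_part w alpha ->
  0 < omega_part w beta ->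
  (forall i : 'I_(n + m), (i < n)%N ->
     (omega_part w alpha + q i) / cabs (alpha + Q i i) * cabs (beta - Q i i)
       < omega_part w beta - q i) ->
  (forall i : 'I_(n + m), (n <= i)%N ->
     (omega_part w beta + q i) / cabs (beta + Q i i) * cabs (alpha - Q i i)
       < omega_part w alpha - q i) ->
  adda_sequences A B C D alpha beta E F G H ->
  adda_well_defined A B C D alpha beta G H /\
  quadratic_cvg H Phi /\ quadratic_cvg G Psi.
Proof.
move=> Q q w01 _ rowpos solPhi solPsi a0 b0 condD condA seqs.
have qlt i : q i < omega_part w (Q i i).
  by have := rowpos i 0; rewrite omega_comparison_row_sum subr_gt0.
have qD i : q (lshift m i) = offdiag D C i := nare_offdiag_left A B C D i.
have qA i : q (rshift n i) = offdiag A B i := nare_offdiag_right A B C D i.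
have QD i : Q (lshift m i) (lshift m i) = D i i by rewrite /Q block_mxEul.
have QA i : Q (rshift n i) (rshift n i) = A i i by rewrite /Q block_mxEdr.
have offD i : offdiag D C i < omega_part w (D i i) by rewrite -qD -QD.
have offA i : offdiag A B i < omega_part w (A i i) by rewrite -qA -QA.
have domD : dominant D C alpha beta (omega_part w alpha) (omega_part w beta).
  move=> i; apply: adda_parameter_dominance; rewrite ?offdiag_ge0 //.
  by rewrite -qD -QD; apply: condD; rewrite /= ltn_ord.
have domA : dominant A B beta alpha (omega_part w beta) (omega_part w alpha).
  move=> i; apply: adda_parameter_dominance; rewrite ?offdiag_ge0 //.
  by rewrite -qA -QA; apply: condA; rewrite /= leq_addr.
have [th th01 [{}domD {}domA]] := dominant_pair_uniform a0 b0 domD domA.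
have [uA uD uW uV] := adda_start_units a0 b0 th01 domD domA.
have [wd cvgH] := adda_converges w01 a0 b0 th01 domD domA offD offA seqs solPhi.
have seqs' := adda_swap uA uD uW uV seqs.
have [_ cvgG] := adda_converges w01 b0 a0 th01 domA domD offA offD seqs' solPsi.
by [].
Qed.
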